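(* Let $M$ be a smooth oriented surface in $E^3$ without umbilic points and without critical points of its mean curvature $H$, with notation as in the context, satisfying $d\alpha_1=0$, $d\alpha_2=\alpha_1\wedge\alpha_2$, and let $(s,t)$ be local coordinates on a connected coordinate rectangle in $M$ in which $\xi_1=e(s)\,ds$, $\xi_2=e(s)\,dt$ with $e(s)>0$ and in which $A,H,J$ are functions of $s$ only. Then the function $Q(s)=H'(s)/J(s)=A(s)e(s)>0$ satisfies the second-order nonlinear differential equation $$Q''(s)Q(s)-(Q'(s))^2=Q(s)^4 .$$ This equation has a first integral of the form $$Q'(s)^2=Q(s)^4+\kappa\,Q(s)^2,\qquad \kappa\in\mathbb R \text{ a constant}.$$
   Context: The surface $M$ carries an orthonormal frame $e_1,e_2,e_3$ with $e_3$ the unit normal and $e_1,e_2$ along principal directions; $\omega_1,\omega_2$ is the coframe dual to $e_1,e_2$, and $\omega_{12}=h\omega_1+k\omega_2$ is the connection form, i.e. $d\omega_1=\omega_{12}\wedge\omega_2$, $d\omega_2=\omega_1\wedge\omega_{12}$. The principal curvatures are $a>c$ (so $\omega_{13}=a\omega_1$, $\omega_{23}=c\omega_2$), $H=\frac12(a+c)$, $J=\frac12(a-c)>0$. By the Codazzi equations there are functions $u,v$ with $\frac{1}{a-c}da-h\omega_2=(u-k)\omega_1$ and $\frac1{a-c}dc-k\omega_1=(v-h)\omega_2$; in particular $dH=J(u\omega_1+v\omega_2)$. Set $A=\sqrt{u^2+v^2}>0$ (positive since $dH\neq0$), and let $\psi$ be a local smooth function with $u=A\cos\psi$, $v=A\sin\psi$.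 Define $\alpha_1=u\omega_1-v\omega_2$, $\alpha_2=v\omega_1+u\omega_2$, and $\xi_1=\cos\psi\,\omega_1+\sin\psi\,\omega_2$, $\xi_2=-\sin\psi\,\omega_1+\cos\psi\,\omega_2$. Thus $dH=AJ\xi_1$. Primes denote $d/ds$. *)

(* Defs.v *)
From Stdlib Require Import Reals.
From Coquelicot Require Import Coquelicot.
Open Scope R_scope.

(** * The coordinate plane *)

Definition in_interval (l r : Rbar) (x : R) : Prop := Rbar_lt l x /\ Rbar_lt x r.

Definition rectangle (s0 s1 t0 t1 : Rbar) (s t : R) : Prop :=
  in_interval s0 s1 s /\ in_interval t0 t1 t.

Definition partial_s (f : R -> R -> R) (s t : R) : R := Derive (fun z => f z t) s.
Definition partial_t (f : R -> R -> R) (s t : R) : R := Derive (fun z => f s z) t.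

(* [ex_diff_n f n] asks for existence and continuity at the point of all the
   iterated partial derivatives of [f], in every order, up to total order [n];
   on an open set [U] this for every [n] is C^infinity. *)
Definition smooth_on (U : R -> R -> Prop) (f : R -> R -> R) : Prop :=
  forall s t, U s t -> forall n, ex_diff_n f n s t.

(** * Differential forms in the coordinates [(s,t)] *)

(* The 1-form [cs ds + ct dt]. *)
Record form1 := Form1 { cs : R -> R -> R; ct : R -> R -> R }.

(* A 2-form is represented by its coefficient on [ds /\ dt]. *)
Definition form2 := R -> R -> R.

Definition fadd (w z : form1) : form1 :=
  Form1 (fun s t => cs w s t + cs z s t) (fun s t => ct w s t + ct z s t).
Definition fsub (w z : form1) : form1 :=
  Form1 (fun s t => cs w s t - cs z s t) (fun s t => ct w s t - ct z s t).
Definition fscale (f : R -> R -> R) (w : form1) : form1 :=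
  Form1 (fun s t => f s t * cs w s t) (fun s t => f s t * ct w s t).

Definition ds_form : form1 := Form1 (fun _ _ => 1) (fun _ _ => 0).
Definition dt_form : form1 := Form1 (fun _ _ => 0) (fun _ _ => 1).

Definition wedge (w z : form1) : form2 :=
  fun s t => cs w s t * ct z s t - ct w s t * cs z s t.

Definition dfun (f : R -> R -> R) : form1 := Form1 (partial_s f) (partial_t f).
Definition dform (w : form1) : form2 :=
  fun s t => partial_s (ct w) s t - partial_t (cs w) s t.

Definition form1_eq (U : R -> R -> Prop) (w z : form1) : Prop :=
  forall s t, U s t -> cs w s t = cs z s t /\ ct w s t = ct z s t.
Definition form2_eq (U : R -> R -> Prop) (w z : form2) : Prop :=
  forall s t, U s t -> w s t = z s t.

(** * Euclidean 3-space *)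

Definition E3 : Type := (R * R * R)%type.
Definition co1 (p : E3) : R := fst (fst p).
Definition co2 (p : E3) : R := snd (fst p).
Definition co3 (p : E3) : R := snd p.

Definition dot (p q : E3) : R := co1 p * co1 q + co2 p * co2 q + co3 p * co3 q.
Definition cross (p q : E3) : E3 :=
  (co2 p * co3 q - co3 p * co2 q,
   co3 p * co1 q - co1 p * co3 q,
   co1 p * co2 q - co2 p * co1 q).

Definition vsmooth_on (U : R -> R -> Prop) (F : R -> R -> E3) : Prop :=
  smooth_on U (fun s t => co1 (F s t)) /\
  smooth_on U (fun s t => co2 (F s t)) /\
  smooth_on U (fun s t => co3 (F s t)).

Definition vpartial_s (F : R -> R -> E3) (s t : R) : E3 :=
  (partial_s (fun x y => co1 (F x y)) s t,
   partial_s (fun x y => co2 (F x y)) s t,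
   partial_s (fun x y => co3 (F x y)) s t).
Definition vpartial_t (F : R -> R -> E3) (s t : R) : E3 :=
  (partial_t (fun x y => co1 (F x y)) s t,
   partial_t (fun x y => co2 (F x y)) s t,
   partial_t (fun x y => co3 (F x y)) s t).

(* The 1-form [<dF, G>]. *)
Definition dot_form (F G : R -> R -> E3) : form1 :=
  Form1 (fun s t => dot (vpartial_s F s t) (G s t))
        (fun s t => dot (vpartial_t F s t) (G s t)).

(** * Surfaces with an adapted frame, in local coordinates *)

(* [X] is the inverse of a coordinate chart followed by the immersion of the
   surface in [E3]; the orientation is the one given by the unit normal
   [e3 = e1 x e2]. *)
Record framed_surface (U : R -> R -> Prop) (X e1 e2 e3 : R -> R -> E3) : Prop := {
  fs_smooth_X : vsmooth_on U X;
  fs_immersion : forall s t, U s t ->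
    cross (vpartial_s X s t) (vpartial_t X s t) <> (0, 0, 0);
  fs_smooth_e1 : vsmooth_on U e1;
  fs_smooth_e2 : vsmooth_on U e2;
  fs_smooth_e3 : vsmooth_on U e3;
  fs_unit1 : forall s t, U s t -> dot (e1 s t) (e1 s t) = 1;
  fs_unit2 : forall s t, U s t -> dot (e2 s t) (e2 s t) = 1;
  fs_orth12 : forall s t, U s t -> dot (e1 s t) (e2 s t) = 0;
  fs_oriented : forall s t, U s t -> e3 s t = cross (e1 s t) (e2 s t);
  fs_normal : forall s t, U s t ->
    dot (vpartial_s X s t) (e3 s t) = 0 /\ dot (vpartial_t X s t) (e3 s t) = 0
}.

(* For a framed surface [dX = omega1 e1 + omega2 e2], so [omega1], [omega2] are
   the coframe dual to [e1], [e2]. *)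
Definition omega1 (X e1 : R -> R -> E3) : form1 := dot_form X e1.
Definition omega2 (X e2 : R -> R -> E3) : form1 := dot_form X e2.

(* [a > c] are the principal curvatures and [e1], [e2] the corresponding
   principal directions: [omega13 = a omega1], [omega23 = c omega2], where
   [omega13 = <de1,e3>] and [omega23 = <de2,e3>]. The strict inequality says
   that there are no umbilic points. *)
Record principal_data (U : R -> R -> Prop) (X e1 e2 e3 : R -> R -> E3)
    (a c : R -> R -> R) : Prop := {
  pd_smooth_a : smooth_on U a;
  pd_smooth_c : smooth_on U c;
  pd_lt : forall s t, U s t -> c s t < a s t;
  pd_omega13 : form1_eq U (dot_form e1 e3) (fscale a (omega1 X e1));
  pd_omega23 : form1_eq U (dot_form e2 e3) (fscale c (omega2 X e2))
}.

Definition omega12 (X e1 e2 : R -> R -> E3) (h k : R -> R -> R) : form1 :=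
  fadd (fscale h (omega1 X e1)) (fscale k (omega2 X e2)).

Record connection_data (U : R -> R -> Prop) (X e1 e2 : R -> R -> E3)
    (h k : R -> R -> R) : Prop := {
  cd_smooth_h : smooth_on U h;
  cd_smooth_k : smooth_on U k;
  cd_domega1 : form2_eq U (dform (omega1 X e1))
                 (wedge (omega12 X e1 e2 h k) (omega2 X e2));
  cd_domega2 : form2_eq U (dform (omega2 X e2))
                 (wedge (omega1 X e1) (omega12 X e1 e2 h k))
}.

Record codazzi_data (U : R -> R -> Prop) (X e1 e2 : R -> R -> E3)
    (a c h k u v : R -> R -> R) : Prop := {
  cz_smooth_u : smooth_on U u;
  cz_smooth_v : smooth_on U v;
  cz_da : form1_eq U
    (fsub (fscale (fun s t => 1 / (a s t - c s t)) (dfun a)) (fscale h (omega2 X e2)))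
    (fscale (fun s t => u s t - k s t) (omega1 X e1));
  cz_dc : form1_eq U
    (fsub (fscale (fun s t => 1 / (a s t - c s t)) (dfun c)) (fscale k (omega1 X e1)))
    (fscale (fun s t => v s t - h s t) (omega2 X e2))
}.

Definition mean_curv (a c : R -> R -> R) (s t : R) : R := (a s t + c s t) / 2.
Definition half_diff (a c : R -> R -> R) (s t : R) : R := (a s t - c s t) / 2.

Definition no_critical_point (U : R -> R -> Prop) (f : R -> R -> R) : Prop :=
  forall s t, U s t -> ~ (partial_s f s t = 0 /\ partial_t f s t = 0).

Definition normA (u v : R -> R -> R) (s t : R) : R := sqrt (u s t ^ 2 + v s t ^ 2).

Definition alpha1 (X e1 e2 : R -> R -> E3) (u v : R -> R -> R) : form1 :=
  fsub (fscale u (omega1 X e1)) (fscale v (omega2 X e2)).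
Definition alpha2 (X e1 e2 : R -> R -> E3) (u v : R -> R -> R) : form1 :=
  fadd (fscale v (omega1 X e1)) (fscale u (omega2 X e2)).

Definition angle_function (U : R -> R -> Prop) (u v psi : R -> R -> R) : Prop :=
  smooth_on U psi /\
  forall s t, U s t ->
    u s t = normA u v s t * cos (psi s t) /\ v s t = normA u v s t * sin (psi s t).

Definition xi1 (X e1 e2 : R -> R -> E3) (psi : R -> R -> R) : form1 :=
  fadd (fscale (fun s t => cos (psi s t)) (omega1 X e1))
       (fscale (fun s t => sin (psi s t)) (omega2 X e2)).
Definition xi2 (X e1 e2 : R -> R -> E3) (psi : R -> R -> R) : form1 :=
  fadd (fscale (fun s t => - sin (psi s t)) (omega1 X e1))
       (fscale (fun s t => cos (psi s t)) (omega2 X e2)).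

(** * The differential equation *)

Definition solves_Q_equation (s0 s1 : Rbar) (q : R -> R) : Prop :=
  forall s, in_interval s0 s1 s ->
    ex_derive q s /\ ex_derive (Derive q) s /\
    Derive (Derive q) s * q s - (Derive q s) ^ 2 = q s ^ 4.

Definition first_integral (s0 s1 : Rbar) (q : R -> R) (kappa : R) : Prop :=
  forall s, in_interval s0 s1 s ->
    (Derive q s) ^ 2 = q s ^ 4 + kappa * q s ^ 2.

(* Main.v *)
Require Import Defs.
From Stdlib Require Import Reals Lra Lia.
From Coquelicot Require Import Coquelicot.
Open Scope R_scope.

(** In the coordinates [(s,t)] one has [alpha1 = Q (cos p ds - sin p dt)] and
    [alpha2 = Q (sin p ds + cos p dt)] with [p = 2 psi], so the two structure
    equations can be solved for [dp]:
    [p_s = - Q sin p] and [p_t = Q'/Q - Q cos p].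
    Equality of the mixed derivatives of [p] reduces to [(Q'/Q)' = Q^2], which
    is the equation for [Q]; it makes [(Q'/Q)^2 - Q^2] constant. *)

Lemma locally_in_interval (l r : Rbar) (x : R) :
  in_interval l r x -> locally x (in_interval l r).
Proof.
  intros [H1 H2].
  apply filter_and.
  - exact (open_Rbar_gt' x l H1).
  - exact (open_Rbar_lt' x r H2).
Qed.

Lemma in_interval_inhabited (l r : Rbar) :
  Rbar_lt l r -> exists x : R, in_interval l r x.
Proof.
  unfold in_interval.
  destruct l as [l| |], r as [r| |]; simpl; intros H; try contradiction.
  - exists ((l + r) / 2); lra.
  - exists (l + 1); split; [lra | exact I].
  - exists (r - 1); split; [exact I | lra].
  - exists 0; split; exact I.
Qed.

Lemma in_interval_convex (l r : Rbar) (x y z : R) :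
  in_interval l r x -> in_interval l r y -> x <= z <= y -> in_interval l r z.
Proof.
  unfold in_interval.
  destruct l as [l| |], r as [r| |]; simpl; lra.
Qed.

Lemma constant_on_interval (l r : Rbar) (f : R -> R) :
  (forall x, in_interval l r x -> is_derive f x 0) ->
  forall x y, in_interval l r x -> in_interval l r y -> f x = f y.
Proof.
  intros Hf x y Hx Hy.
  destruct (Rtotal_order x y) as [Hxy | [-> | Hxy]].
  - apply eq_is_derive; [| exact Hxy].
    intros z Hz; apply Hf; exact (in_interval_convex l r x y z Hx Hy Hz).
  - reflexivity.
  - symmetry; apply eq_is_derive; [| exact Hxy].
    intros z Hz; apply Hf; exact (in_interval_convex l r y x z Hy Hx Hz).
Qed.

(** * The first integral *)

(** The quantity [K = (q'/q)^2 - q^2] has derivative [2 (q'/q) ((q'/q)' - q^2)]. Division of the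
    equation by [q^2] turns it into [(q'/q)' = q^2], so [K] is constant, and its value is
    [kappa]. *)
Lemma first_integral_of_solution (l r : Rbar) (q : R -> R) :
  (forall s, in_interval l r s -> 0 < q s) ->
  solves_Q_equation l r q ->
  exists kappa : R, first_integral l r q kappa.
Proof.
  intros Hpos Hq.
  set (K := fun s => (Derive q s / q s) ^ 2 - q s ^ 2).
  assert (HK : forall s, in_interval l r s -> is_derive K s 0).
  { intros s Hs.
    destruct (Hq s Hs) as (Hd1 & Hd2 & Heq).
    pose proof (Hpos s Hs) as Hp.
    unfold K.
    auto_derive.
    - repeat split; auto; lra.
    - change (Derive (fun x => q x) s) with (Derive q s).
      change (Derive (fun x => Derive q x) s) with (Derive (Derive q) s).
      (* This is the equation solved for [q'']. *)
      replace (Derive (Derive q) s) with ((q s ^ 4 + Derive q s ^ 2) / q s)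
        by (rewrite <- Heq; field; lra).
      field; lra. }
  destruct (Rbar_lt_dec l r) as [Hlr | Hlr].
  - destruct (in_interval_inhabited l r Hlr) as [m Hm].
    exists (K m); intros s Hs.
    rewrite (constant_on_interval l r K HK m s Hm Hs).
    pose proof (Hpos s Hs) as Hp.
    unfold K; field; lra.
  (* Here the interval is empty, so any constant serves. *)
  - exists 0; intros s [H1 H2].
    contradiction (Hlr (Rbar_lt_trans _ _ _ H1 H2)).
Qed.

(** * Calculus of smooth functions on an open rectangle *)

Lemma locally_2d_rectangle (s0 s1 t0 t1 : Rbar) (s t : R) :
  rectangle s0 s1 t0 t1 s t -> locally_2d (rectangle s0 s1 t0 t1) s t.
Proof.
  intros [Hs Ht].
  destruct (locally_in_interval _ _ _ Hs) as [d1 H1].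
  destruct (locally_in_interval _ _ _ Ht) as [d2 H2].
  exists (mkposreal _ (Rmin_stable_in_posreal d1 d2)); simpl; intros x y Hx Hy.
  split.
  - apply H1; exact (Rlt_le_trans _ _ _ Hx (Rmin_l _ _)).
  - apply H2; exact (Rlt_le_trans _ _ _ Hy (Rmin_r _ _)).
Qed.

Lemma partial_ext_rectangle (s0 s1 t0 t1 : Rbar) (f g : R -> R -> R) :
  (forall s t, rectangle s0 s1 t0 t1 s t -> f s t = g s t) ->
  forall s t, rectangle s0 s1 t0 t1 s t ->
    partial_s f s t = partial_s g s t /\ partial_t f s t = partial_t g s t.
Proof.
  intros Hfg s t [Hs Ht]; split; apply Derive_ext_loc.
  - apply (filter_imp (in_interval s0 s1)).
    + intros x Hx; apply Hfg; split; assumption.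
    + exact (locally_in_interval _ _ _ Hs).
  - apply (filter_imp (in_interval t0 t1)).
    + intros x Hx; apply Hfg; split; assumption.
    + exact (locally_in_interval _ _ _ Ht).
Qed.

Lemma smooth_on_partial_s (U : R -> R -> Prop) (f : R -> R -> R) :
  smooth_on U f -> smooth_on U (partial_s f).
Proof. intros Hf s t Hst n; apply (Hf s t Hst (S n)). Qed.

Lemma smooth_on_partial_t (U : R -> R -> Prop) (f : R -> R -> R) :
  smooth_on U f -> smooth_on U (partial_t f).
Proof. intros Hf s t Hst n; apply (Hf s t Hst (S n)). Qed.

Lemma smooth_on_ex_derive (U : R -> R -> Prop) (f : R -> R -> R) (s t : R) :
  smooth_on U f -> U s t ->
  ex_derive (fun x => f x t) s /\ ex_derive (fun y => f s y) t.
Proof. intros Hf Hst; destruct (Hf s t Hst 1%nat) as (_ & H1 & H2 & _); auto. Qed.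

Lemma smooth_on_continuity (U : R -> R -> Prop) (f : R -> R -> R) (s t : R) :
  smooth_on U f -> U s t -> continuity_2d_pt f s t.
Proof. intros Hf Hst; apply (Hf s t Hst 0%nat). Qed.

(** Schwarz's theorem asks for the derivatives to exist on a neighbourhood and for the mixed ones to
    be continuous at the point. The neighbourhood comes from the openness of the rectangle, since
    [smooth_on] is a pointwise condition. *)
Lemma smooth_on_mixed_partials (s0 s1 t0 t1 : Rbar) (f : R -> R -> R) (s t : R) :
  smooth_on (rectangle s0 s1 t0 t1) f -> rectangle s0 s1 t0 t1 s t ->
  partial_s (partial_t f) s t = partial_t (partial_s f) s t.
Proof.
  intros Hf Hst.
  pose proof (smooth_on_partial_s _ _ Hf) as Hfs.
  pose proof (smooth_on_partial_t _ _ Hf) as Hft.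
  apply Schwarz.
  - apply (locally_2d_impl_strong (rectangle s0 s1 t0 t1));
      [| exact (locally_2d_rectangle _ _ _ _ _ _ Hst)].
    apply locally_2d_forall; intros x y Hxy.
    apply locally_2d_singleton in Hxy.
    destruct (smooth_on_ex_derive _ _ _ _ Hf Hxy).
    repeat split; auto.
    + apply (smooth_on_ex_derive _ _ _ _ Hft Hxy).
    + apply (smooth_on_ex_derive _ _ _ _ Hfs Hxy).
  - exact (smooth_on_continuity _ _ _ _ (smooth_on_partial_s _ _ Hft) Hst).
  - exact (smooth_on_continuity _ _ _ _ (smooth_on_partial_t _ _ Hfs) Hst).
Qed.

(** This carries smoothness of a function on the rectangle that depends on [s] alone over to its
    one-variable profile. The induction replaces the pair [f], [g] by [partial_s f], [Derive g],
    which again agree on the rectangle. *)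
Lemma smooth_on_profile (s0 s1 t0 t1 : Rbar) (t : R) (n : nat)
    (f : R -> R -> R) (g : R -> R) :
  in_interval t0 t1 t ->
  smooth_on (rectangle s0 s1 t0 t1) f ->
  (forall s y, rectangle s0 s1 t0 t1 s y -> f s y = g s) ->
  forall s, in_interval s0 s1 s -> ex_derive_n g n s.
Proof.
  intros Ht; revert f g.
  induction n as [| n IHn]; intros f g Hf Hfg s Hs; [exact I |].
  assert (Hloc : locally s (fun x => f x t = g x)).
  { apply (filter_imp (in_interval s0 s1)); [| exact (locally_in_interval _ _ _ Hs)].
    intros x Hx; apply Hfg; split; assumption. }
  (* Order one is treated separately: [ex_derive_n] at order zero is [True], so the induction
     hypothesis says nothing there. *)
  destruct n as [| n].
  - change (ex_derive g s).
    apply (ex_derive_ext_loc (fun x => f x t) g s Hloc).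
    exact (proj1 (smooth_on_ex_derive _ f s t Hf (conj Hs Ht))).
  - pose proof (IHn (partial_s f) (Derive g) (smooth_on_partial_s _ _ Hf)) as IH.
    assert (Hd : ex_derive_n (Derive g) (S n) s).
    { apply IH; [| exact Hs].
      intros x y Hxy.
      exact (proj1 (partial_ext_rectangle _ _ _ _ f (fun x _ => g x) Hfg x y Hxy)). }
    simpl in Hd |- *.
    apply (ex_derive_ext (Derive_n (Derive g) n)); [| exact Hd].
    intros x; change (Derive_n (Derive_n g 1) n x = Derive_n g (S n) x).
    rewrite Derive_n_comp.
    replace (n + 1)%nat with (S n) by lia; reflexivity.
Qed.

Lemma ex_derive2_div (l r : Rbar) (f g : R -> R) :
  (forall s, in_interval l r s -> g s <> 0) ->
  (forall s, in_interval l r s -> ex_derive f s /\ ex_derive (Derive f) s) ->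
  (forall s, in_interval l r s -> ex_derive g s /\ ex_derive (Derive g) s) ->
  forall s, in_interval l r s ->
    ex_derive (fun x => f x / g x) s /\ ex_derive (Derive (fun x => f x / g x)) s.
Proof.
  intros Hg0 Hf Hg s Hs; split.
  - apply ex_derive_div; [apply Hf | apply Hg | apply Hg0]; exact Hs.
  - apply (ex_derive_ext_loc
      (fun x => (Derive f x * g x - f x * Derive g x) / g x ^ 2)).
    + apply (filter_imp (in_interval l r)); [| exact (locally_in_interval _ _ _ Hs)].
      intros x Hx; symmetry.
      apply Derive_div; [apply Hf | apply Hg | apply Hg0]; exact Hx.
    + destruct (Hf s Hs), (Hg s Hs); pose proof (Hg0 s Hs).
      apply ex_derive_div.
      * apply (ex_derive_minus (V := R_NormedModule)); apply ex_derive_mult; assumption.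
      * apply ex_derive_pow; assumption.
      * apply pow_nonzero; assumption.
Qed.

(** * The structure equations as a system for the angle *)

(** With [p = 2 psi], the derivative of [p_t] in [s] is [(q'/q)' - q' cos p - q^2 sin^2 p], and that
    of [p_s] in [t] is [- q' cos p + q^2 cos^2 p]. Equating them cancels [q' cos p] and joins the
    squares, so the angle drops out and [(q'/q)' = q^2] remains. *)
Lemma angle_integrability (s0 s1 t0 t1 : Rbar) (psi : R -> R -> R) (q : R -> R) :
  smooth_on (rectangle s0 s1 t0 t1) psi ->
  (forall s, in_interval s0 s1 s -> q s <> 0) ->
  (forall s, in_interval s0 s1 s -> ex_derive q s /\ ex_derive (Derive q) s) ->
  (forall s t, rectangle s0 s1 t0 t1 s t ->
     partial_s psi s t = - q s * sin (2 * psi s t) / 2 /\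
     partial_t psi s t = (Derive q s / q s - q s * cos (2 * psi s t)) / 2) ->
  forall s t, rectangle s0 s1 t0 t1 s t ->
    Derive (Derive q) s * q s - Derive q s ^ 2 = q s ^ 4.
Proof.
  intros Hpsi Hq0 Hq Hd s t Hst.
  pose proof (smooth_on_mixed_partials _ _ _ _ _ _ _ Hpsi Hst) as Hmix.
  (* The formulas for the first derivatives of [psi] hold on the whole open rectangle, so they may
     be differentiated once more. *)
  rewrite (proj1 (partial_ext_rectangle _ _ _ _ _ _
    (fun x y Hxy => proj2 (Hd x y Hxy)) s t Hst)) in Hmix.
  rewrite (proj2 (partial_ext_rectangle _ _ _ _ _ _
    (fun x y Hxy => proj1 (Hd x y Hxy)) s t Hst)) in Hmix.
  destruct (Hd s t Hst) as [Hs Ht].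
  destruct (smooth_on_ex_derive _ _ _ _ Hpsi Hst) as [Es Et].
  destruct (Hq s (proj1 Hst)) as [Eq1 Eq2].
  pose proof (Hq0 s (proj1 Hst)) as Hq0s.
  unfold partial_s, partial_t in *.
  set (p := 2 * psi s t) in *.
  (* In [L] and [R] the derivative of [psi] produced by the chain rule is already replaced by its
     known value. *)
  assert (L : is_derive
    (fun z => (Derive q z / q z - q z * cos (2 * psi z t)) / 2) s
    (((Derive (Derive q) s * q s - Derive q s ^ 2) / q s ^ 2
      - Derive q s * cos p
      + q s * sin p * (2 * (- q s * sin p / 2))) / 2)).
  { rewrite <- Hs; unfold p; auto_derive.
    - repeat split; auto.
    - change (Derive (fun x => q x) s) with (Derive q s).
      change (Derive (fun x => Derive q x) s) with (Derive (Derive q) s).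
      change (Derive (fun x => psi x t) s) with (Derive (fun z => psi z t) s).
      field; auto. }
  assert (R : is_derive
    (fun z => - q s * sin (2 * psi s z) / 2) t
    (- q s * cos p * (2 * ((Derive q s / q s - q s * cos p) / 2)) / 2)).
  { rewrite <- Ht; unfold p; auto_derive.
    - repeat split; auto.
    - change (Derive (fun x => psi s x) t) with (Derive (fun z => psi s z) t).
      field; auto. }
  apply is_derive_unique in L, R.
  pose proof (eq_trans (eq_sym L) (eq_trans Hmix R)) as Heq; clear L R Hmix.
  assert (HW : (Derive (Derive q) s * q s - Derive q s ^ 2) / q s ^ 2 = q s ^ 2).
  { pose proof (sin2_cos2 p) as Hp; unfold Rsqr in Hp.
    assert (Hf : - q s * cos p * (2 * ((Derive q s / q s - q s * cos p) / 2)) / 2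
      = (- Derive q s * cos p + q s ^ 2 * (cos p * cos p)) / 2) by (field; auto).
    rewrite Hf in Heq.
    replace (cos p * cos p) with (1 - sin p * sin p) in Heq by lra.
    lra. }
  replace (q s ^ 4) with (q s ^ 2 * q s ^ 2) by ring.
  rewrite <- HW at 1; field; auto.
Qed.

(** The hypothesis on the coefficients reads [w1 + i w2 = q exp(i p) (ds + i dt)] with [p = 2 psi],
    so the wedge of [w1] and [w2] has coefficient [q^2]. The two structure equations are then linear
    in [p_s] and [p_t], with matrix [q] times a rotation, hence solvable because [q] does not
    vanish. *)
Lemma polar_structure_equations (s0 s1 t0 t1 : Rbar) (psi : R -> R -> R) (q : R -> R)
    (w1 w2 : Defs.form1) :
  smooth_on (rectangle s0 s1 t0 t1) psi ->
  (forall s, in_interval s0 s1 s -> q s <> 0) ->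
  (forall s, in_interval s0 s1 s -> ex_derive q s) ->
  (forall s t, rectangle s0 s1 t0 t1 s t ->
     (cs w1 s t = q s * cos (2 * psi s t) /\ ct w1 s t = - q s * sin (2 * psi s t)) /\
     (cs w2 s t = q s * sin (2 * psi s t) /\ ct w2 s t = q s * cos (2 * psi s t))) ->
  form2_eq (rectangle s0 s1 t0 t1) (dform w1) (fun _ _ => 0) ->
  form2_eq (rectangle s0 s1 t0 t1) (dform w2) (wedge w1 w2) ->
  forall s t, rectangle s0 s1 t0 t1 s t ->
    partial_s psi s t = - q s * sin (2 * psi s t) / 2 /\
    partial_t psi s t = (Derive q s / q s - q s * cos (2 * psi s t)) / 2.
Proof.
  intros Hpsi Hq0 Hq Hw H1 H2 s t Hst.
  specialize (H1 s t Hst); specialize (H2 s t Hst).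
  unfold dform, wedge in H1, H2.
  rewrite (proj1 (partial_ext_rectangle _ _ _ _ _ _
    (fun x y Hxy => proj2 (proj1 (Hw x y Hxy))) s t Hst)) in H1.
  rewrite (proj2 (partial_ext_rectangle _ _ _ _ _ _
    (fun x y Hxy => proj1 (proj1 (Hw x y Hxy))) s t Hst)) in H1.
  rewrite (proj1 (partial_ext_rectangle _ _ _ _ _ _
    (fun x y Hxy => proj2 (proj2 (Hw x y Hxy))) s t Hst)) in H2.
  rewrite (proj2 (partial_ext_rectangle _ _ _ _ _ _
    (fun x y Hxy => proj1 (proj2 (Hw x y Hxy))) s t Hst)) in H2.
  destruct (Hw s t Hst) as [[-> ->] [-> ->]] in H2.
  destruct (smooth_on_ex_derive _ _ _ _ Hpsi Hst) as [Es Et].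
  pose proof (Hq s (proj1 Hst)) as Eq.
  pose proof (Hq0 s (proj1 Hst)) as Hq0s.
  unfold partial_s, partial_t in *.
  set (ps := Derive (fun z => psi z t) s) in *.
  set (pt := Derive (fun z => psi s z) t) in *.
  set (p := 2 * psi s t) in *.
  assert (D1 : is_derive (fun z => - q z * sin (2 * psi z t)) s
    (- Derive q s * sin p - q s * cos p * (2 * ps))).
  { unfold p, ps; auto_derive; [repeat split; auto |].
    change (Derive (fun x => q x) s) with (Derive q s).
    change (Derive (fun x => psi x t) s) with (Derive (fun z => psi z t) s); ring. }
  assert (D2 : is_derive (fun z => q s * cos (2 * psi s z)) t
    (- q s * sin p * (2 * pt))).
  { unfold p, pt; auto_derive; [repeat split; auto |].
    change (Derive (fun x => psi s x) t) with (Derive (fun z => psi s z) t); ring. }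
  assert (D3 : is_derive (fun z => q z * cos (2 * psi z t)) s
    (Derive q s * cos p - q s * sin p * (2 * ps))).
  { unfold p, ps; auto_derive; [repeat split; auto |].
    change (Derive (fun x => q x) s) with (Derive q s).
    change (Derive (fun x => psi x t) s) with (Derive (fun z => psi z t) s); ring. }
  assert (D4 : is_derive (fun z => q s * sin (2 * psi s z)) t
    (q s * cos p * (2 * pt))).
  { unfold p, pt; auto_derive; [repeat split; auto |].
    change (Derive (fun x => psi s x) t) with (Derive (fun z => psi s z) t); ring. }
  apply is_derive_unique in D1, D2, D3, D4.
  pose proof (eq_trans (f_equal2 Rminus (eq_sym D1) (eq_sym D2)) H1) as F1.
  pose proof (eq_trans (f_equal2 Rminus (eq_sym D3) (eq_sym D4)) H2) as F2.
  clear D1 D2 D3 D4 H1 H2.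
  pose proof (sin2_cos2 p) as Hp; unfold Rsqr in Hp.
  assert (Hc : cos p * cos p = 1 - sin p * sin p) by lra.
  (* Rotating the two equations by the angle [p] separates the derivatives. *)
  assert (G1 : 2 * (q s * ps) = - sin p * q s ^ 2).
  { transitivity
      (- cos p * (- Derive q s * sin p - q s * cos p * (2 * ps)
                  - - q s * sin p * (2 * pt))
       - sin p * (Derive q s * cos p - q s * sin p * (2 * ps)
                  - q s * cos p * (2 * pt))).
    - ring_simplify; replace (cos p ^ 2) with (1 - sin p ^ 2) by (simpl; lra); ring.
    - rewrite F1, F2; ring_simplify.
      replace (cos p ^ 2) with (1 - sin p ^ 2) by (simpl; lra); ring. }
  assert (G2 : Derive q s - 2 * (q s * pt) = cos p * q s ^ 2).
  { transitivity
      (- sin p * (- Derive q s * sin p - q s * cos p * (2 * ps)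
                  - - q s * sin p * (2 * pt))
       + cos p * (Derive q s * cos p - q s * sin p * (2 * ps)
                  - q s * cos p * (2 * pt))).
    - ring_simplify; replace (cos p ^ 2) with (1 - sin p ^ 2) by (simpl; lra); ring.
    - rewrite F1, F2; ring_simplify.
      replace (cos p ^ 3) with (cos p * (1 - sin p ^ 2)) by (simpl; rewrite !Rmult_1_r, Hc; ring).
      ring. }
  split; apply (Rmult_eq_reg_l (q s)); try exact Hq0s.
  - lra.
  - replace (Derive q s) with (cos p * q s ^ 2 + 2 * (q s * pt)) by lra.
    field; auto.
Qed.

(** * From the surface to the equation for [Q] *)

(** The forms [xi1], [xi2] arise from [omega1], [omega2] by a rotation with cosine [C] and sine [S].
    Applying the transposed rotation to [e ds], [e dt] recovers the coframe. *)
Lemma dual_coframe (C S e w1s w1t w2s w2t : R) :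
  C * C + S * S = 1 ->
  C * w1s + S * w2s = e -> C * w1t + S * w2t = 0 ->
  - S * w1s + C * w2s = 0 -> - S * w1t + C * w2t = e ->
  (w1s = e * C /\ w1t = - e * S) /\ (w2s = e * S /\ w2t = e * C).
Proof.
  intros HCS H1 H2 H3 H4; repeat split.
  - transitivity (C * (C * w1s + S * w2s) - S * (- S * w1s + C * w2s)).
    + transitivity ((C * C + S * S) * w1s); [rewrite HCS |]; ring.
    + rewrite H1, H3; ring.
  - transitivity (C * (C * w1t + S * w2t) - S * (- S * w1t + C * w2t)).
    + transitivity ((C * C + S * S) * w1t); [rewrite HCS |]; ring.
    + rewrite H2, H4; ring.
  - transitivity (S * (C * w1s + S * w2s) + C * (- S * w1s + C * w2s)).
    + transitivity ((C * C + S * S) * w2s); [rewrite HCS |]; ring.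
    + rewrite H1, H3; ring.
  - transitivity (S * (C * w1t + S * w2t) + C * (- S * w1t + C * w2t)).
    + transitivity ((C * C + S * S) * w2t); [rewrite HCS |]; ring.
    + rewrite H2, H4; ring.
Qed.

Theorem theorem6p2
  (s0 s1 t0 t1 : Rbar) (hs : Rbar_lt s0 s1) (ht : Rbar_lt t0 t1)
  (X e1 e2 e3 : R -> R -> E3) (a c h k u v psi : R -> R -> R)
  (hM : framed_surface (rectangle s0 s1 t0 t1) X e1 e2 e3)
  (hac : principal_data (rectangle s0 s1 t0 t1) X e1 e2 e3 a c)
  (hhk : connection_data (rectangle s0 s1 t0 t1) X e1 e2 h k)
  (huv : codazzi_data (rectangle s0 s1 t0 t1) X e1 e2 a c h k u v)
  (hcrit : no_critical_point (rectangle s0 s1 t0 t1) (mean_curv a c))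
  (hpsi : angle_function (rectangle s0 s1 t0 t1) u v psi)
  (hdalpha1 : form2_eq (rectangle s0 s1 t0 t1)
                (dform (alpha1 X e1 e2 u v)) (fun _ _ => 0))
  (hdalpha2 : form2_eq (rectangle s0 s1 t0 t1)
                (dform (alpha2 X e1 e2 u v))
                (wedge (alpha1 X e1 e2 u v) (alpha2 X e1 e2 u v)))
  (e A H J : R -> R)
  (he : forall s, in_interval s0 s1 s -> 0 < e s)
  (hxi1 : form1_eq (rectangle s0 s1 t0 t1)
            (xi1 X e1 e2 psi) (fscale (fun s _ => e s) ds_form))
  (hxi2 : form1_eq (rectangle s0 s1 t0 t1)
            (xi2 X e1 e2 psi) (fscale (fun s _ => e s) dt_form))
  (hA : forall s t, rectangle s0 s1 t0 t1 s t -> normA u v s t = A s)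
  (hH : forall s t, rectangle s0 s1 t0 t1 s t -> mean_curv a c s t = H s)
  (hJ : forall s t, rectangle s0 s1 t0 t1 s t -> half_diff a c s t = J s) :
  let Q := fun s => Derive H s / J s in
  (forall s, in_interval s0 s1 s -> Q s = A s * e s /\ 0 < Q s) /\
  solves_Q_equation s0 s1 Q /\
  (exists kappa : R, first_integral s0 s1 Q kappa) /\
  (forall q : R -> R,
     (forall s, in_interval s0 s1 s -> 0 < q s) ->
     solves_Q_equation s0 s1 q ->
     exists kappa : R, first_integral s0 s1 q kappa).
Proof.
  intros Q.
  destruct hpsi as [Hpsi Hangle].
  pose proof (pd_smooth_a _ _ _ _ _ _ _ hac) as Ha.
  pose proof (pd_smooth_c _ _ _ _ _ _ _ hac) as Hc.
  (* A fixed height [tm] places a point of the rectangle above every [s], so that facts on the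
     rectangle yield facts about functions of [s] alone. *)
  destruct (in_interval_inhabited t0 t1 ht) as [tm Htm].
  assert (Hom : forall s t, rectangle s0 s1 t0 t1 s t ->
    (cs (omega1 X e1) s t = e s * cos (psi s t) /\
     ct (omega1 X e1) s t = - e s * sin (psi s t)) /\
    (cs (omega2 X e2) s t = e s * sin (psi s t) /\
     ct (omega2 X e2) s t = e s * cos (psi s t))).
  { intros s t Hst.
    destruct (hxi1 s t Hst) as [E1 E2], (hxi2 s t Hst) as [E3' E4].
    cbn [cs ct xi1 xi2 fadd fscale ds_form dt_form] in E1, E2, E3', E4.
    pose proof (sin2_cos2 (psi s t)) as Hp; unfold Rsqr in Hp.
    apply dual_coframe; lra. }
  assert (HJpos : forall s, in_interval s0 s1 s -> 0 < J s).
  { intros s Hs; rewrite <- (hJ s tm (conj Hs Htm)).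
    pose proof (pd_lt _ _ _ _ _ _ _ hac s tm (conj Hs Htm)).
    unfold half_diff; lra. }
  (* This is [dH = J (u omega1 + v omega2) = A J xi1 = A J e ds] in coefficients. *)
  assert (HdH : forall s t, rectangle s0 s1 t0 t1 s t ->
    partial_s (mean_curv a c) s t = J s * (A s * e s) /\
    partial_t (mean_curv a c) s t = 0).
  { intros s t Hst.
    (* In the sum of the two Codazzi equations the terms with [h] and [k] cancel. *)
    assert (Hsum : forall da dc m n o1 o2 : R,
      da - m * o2 = (u s t - n) * o1 -> dc - n * o1 = (v s t - m) * o2 ->
      da + dc = u s t * o1 + v s t * o2).
    { intros da dc m n o1 o2 E1 E2; lra. }
    destruct (cz_da _ _ _ _ _ _ _ _ _ _ huv s t Hst) as [A1 A2].
    destruct (cz_dc _ _ _ _ _ _ _ _ _ _ huv s t Hst) as [C1 C2].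
    cbn [cs ct fsub fscale dfun] in A1, A2, C1, C2.
    destruct (Hom s t Hst) as [[O1 O2] [O3 O4]].
    destruct (Hangle s t Hst) as [Hu Hv].
    rewrite (hA s t Hst) in Hu, Hv.
    pose proof (pd_lt _ _ _ _ _ _ _ hac s t Hst) as Hlt.
    pose proof (hJ s t Hst) as HJst; unfold half_diff in HJst.
    destruct (smooth_on_ex_derive _ _ _ _ Ha Hst) as [Ea1 Ea2].
    destruct (smooth_on_ex_derive _ _ _ _ Hc Hst) as [Ec1 Ec2].
    pose proof (sin2_cos2 (psi s t)) as Hp; unfold Rsqr in Hp.
    assert (Ms : partial_s (mean_curv a c) s t = (partial_s a s t + partial_s c s t) / 2).
    { apply is_derive_unique; unfold mean_curv, partial_s; auto_derive; auto; lra. }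
    assert (Mt : partial_t (mean_curv a c) s t = (partial_t a s t + partial_t c s t) / 2).
    { apply is_derive_unique; unfold mean_curv, partial_t; auto_derive; auto; lra. }
    assert (Hhalf : forall da dc : R,
      (da + dc) / 2 = J s * (1 / (a s t - c s t) * da + 1 / (a s t - c s t) * dc)).
    { intros da dc; rewrite <- HJst; field; lra. }
    rewrite Ms, Mt, !Hhalf; split.
    - f_equal.
      rewrite (Hsum _ _ _ _ _ _ A1 C1), O1, O3, Hu, Hv.
      transitivity (A s * e s * (sin (psi s t) * sin (psi s t)
                                 + cos (psi s t) * cos (psi s t))); [ring |].
      rewrite Hp; ring.
    - apply Rmult_eq_0_compat_l.
      rewrite (Hsum _ _ _ _ _ _ A2 C2), O2, O4, Hu, Hv; ring. }
  assert (HQ : forall s, in_interval s0 s1 s -> Q s = A s * e s /\ 0 < Q s).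
  { intros s Hs.
    assert (Hst : rectangle s0 s1 t0 t1 s tm) by (split; assumption).
    destruct (HdH s tm Hst) as [D1 D2].
    pose proof (HJpos s Hs) as HJs.
    assert (HDH : Derive H s = J s * (A s * e s)).
    { rewrite <- D1; symmetry.
      exact (proj1 (partial_ext_rectangle _ _ _ _ _ (fun x _ => H x) hH s tm Hst)). }
    assert (EQ : Q s = A s * e s) by (unfold Q; rewrite HDH; field; lra).
    split; [exact EQ |].
    rewrite EQ; apply Rmult_lt_0_compat; [| exact (he s Hs)].
    (* As a square root [A] is nonnegative; if it vanished, [dH] would vanish too, against the
       absence of critical points. *)
    assert (HA0 : 0 <= A s) by (rewrite <- (hA s tm Hst); apply sqrt_pos).
    destruct HA0 as [HA0 | HA0]; [exact HA0 |].
    exfalso; apply (hcrit s tm Hst); split; [| exact D2].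
    rewrite D1, <- HA0; ring. }
  assert (HQ0 : forall s, in_interval s0 s1 s -> Q s <> 0).
  { intros s Hs; pose proof (proj2 (HQ s Hs)); lra. }
  (* Since [a = H + J] and [c = H - J], differentiability of the profiles [H] and [J] follows from
     smoothness of the principal curvatures. The rules for sums of higher derivatives need all lower
     orders on a neighbourhood, supplied by [La] and [Lc]. *)
  assert (HHJ : forall n s, in_interval s0 s1 s -> ex_derive_n H n s /\ ex_derive_n J n s).
  { intros n s Hs.
    assert (Pa : forall n s, in_interval s0 s1 s -> ex_derive_n (fun x => H x + J x) n s).
    { intros m; apply (smooth_on_profile s0 s1 t0 t1 tm m a); auto.
      intros x y Hxy; rewrite <- (hH x y Hxy), <- (hJ x y Hxy).
      unfold mean_curv, half_diff; lra. }
    assert (Pc : forall n s, in_interval s0 s1 s -> ex_derive_n (fun x => H x - J x) n s).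
    { intros m; apply (smooth_on_profile s0 s1 t0 t1 tm m c); auto.
      intros x y Hxy; rewrite <- (hH x y Hxy), <- (hJ x y Hxy).
      unfold mean_curv, half_diff; lra. }
    assert (La : locally s (fun y => forall m, (m <= n)%nat ->
        ex_derive_n (fun x => H x + J x) m y)).
    { apply (filter_imp (in_interval s0 s1)); [auto | exact (locally_in_interval _ _ _ Hs)]. }
    assert (Lc : locally s (fun y => forall m, (m <= n)%nat ->
        ex_derive_n (fun x => H x - J x) m y)).
    { apply (filter_imp (in_interval s0 s1)); [auto | exact (locally_in_interval _ _ _ Hs)]. }
    split.
    - apply (ex_derive_n_ext (fun x => / 2 * ((H x + J x) + (H x - J x)))).
      + intros x; field.
      + apply ex_derive_n_scal_l, ex_derive_n_plus; assumption.
    - apply (ex_derive_n_ext (fun x => / 2 * ((H x + J x) - (H x - J x)))).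
      + intros x; field.
      + apply ex_derive_n_scal_l, ex_derive_n_minus; assumption. }
  assert (HQ2 : forall s, in_interval s0 s1 s -> ex_derive Q s /\ ex_derive (Derive Q) s).
  { apply ex_derive2_div.
    - intros s Hs; pose proof (HJpos s Hs); lra.
    (* The numerator of [Q] is already [H'], so the orders for [H] are shifted up by one. *)
    - intros s Hs; split; [apply (HHJ 2%nat s Hs) | apply (HHJ 3%nat s Hs)].
    - intros s Hs; split; [apply (HHJ 1%nat s Hs) | apply (HHJ 2%nat s Hs)]. }
  (* In complex form [alpha1 + i alpha2 = (u + i v)(omega1 + i omega2)]. Both factors carry the
     phase [psi], which gives [A e exp(2 i psi) (ds + i dt)], and [A e = Q]. *)
  assert (Halpha : forall s t, rectangle s0 s1 t0 t1 s t ->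
    (cs (alpha1 X e1 e2 u v) s t = Q s * cos (2 * psi s t) /\
     ct (alpha1 X e1 e2 u v) s t = - Q s * sin (2 * psi s t)) /\
    (cs (alpha2 X e1 e2 u v) s t = Q s * sin (2 * psi s t) /\
     ct (alpha2 X e1 e2 u v) s t = Q s * cos (2 * psi s t))).
  { intros s t Hst.
    destruct (Hom s t Hst) as [[O1 O2] [O3 O4]].
    destruct (Hangle s t Hst) as [Hu Hv].
    rewrite (hA s t Hst) in Hu, Hv.
    cbn [cs ct alpha1 alpha2 fadd fsub fscale].
    rewrite O1, O2, O3, O4, Hu, Hv, (proj1 (HQ s (proj1 Hst))), cos_2a, sin_2a.
    repeat split; ring. }
  assert (HQeq : solves_Q_equation s0 s1 Q).
  { intros s Hs; destruct (HQ2 s Hs) as [D1 D2].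
    split; [exact D1 | split; [exact D2 |]].
    apply (angle_integrability s0 s1 t0 t1 psi Q Hpsi HQ0 HQ2) with (t := tm);
      [| split; assumption].
    apply (polar_structure_equations _ _ _ _ _ _
      (alpha1 X e1 e2 u v) (alpha2 X e1 e2 u v)); auto.
    intros x Hx; apply (HQ2 x Hx). }
  split; [exact HQ |].
  split; [exact HQeq |].
  split; [| exact (first_integral_of_solution s0 s1)].
  apply first_integral_of_solution; [| exact HQeq].
  intros s Hs; apply (HQ s Hs).
Qed.
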